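(* Let $n$ be an integer with $n = 5$ or $n \ge 7$, and let $G$ be the finite simple undirected graph with $2n+4$ pairwise distinct vertices $$V(G) = \{a_1, a_2, a_3, b_1, b_2, \dots, b_{n+1}, c_1, c_2, \dots, c_{n-1}, d\}$$ whose edge set is defined, according to the parity of $n$, as follows. If $n$ is odd (so $n \ge 5$): \begin{align*} E(G) &= \{a_i b_j \mid i \le j,\ 1 \le i \le 3,\ 1 \le j \le n+1\} \\ &\quad \cup \{b_j b_l \mid 1 \le j < l \le n+1\} \\ &\quad \cup \{b_j c_k \mid 1 \le k \le n-1,\ 1 \le j \le n,\ k \le j+1\} \\ &\quad \cup \{c_k c_m \mid 1 \le k < m \le n-1\} \\ &\quad \cup \{b_j d \mid 2 \le j \le n-1\} \cup \{a_3 c_{n-1},\ a_2 d\}. \end{align*} If $n$ is even (so $n \ge 8$): \begin{align*} E(G) &= \{a_i b_j \mid i \le j,\ 1 \le i \le 3,\ 1 \le j \le n+1\} \\ &\quad \cup \{b_j b_l \mid 1 \le j < l \le n+1\} \\ &\quad \cup \{b_j c_k \mid 1 \le k \le n-1,\ 1 \le j \le n,\ 1 \le k \le j+1\} \\ &\quad \cup \{c_k c_m \mid 1 \le k < m \le n-1\} \\ &\quad \cup \{b_j d \mid 2 \le j \le n-3\} \cup \{a_3 c_{n-1},\ a_1 d,\ a_2 d,\ b_{n+1} d\}. \end{align*} Then $G$ is not $K_n$-irregular.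
   Context: $K_n$ denotes the complete graph of order $n$, and $uv$ denotes the undirected edge joining vertices $u$ and $v$. For a fixed graph $F$, the $F$-degree of a vertex $v$ in a graph $G$ is the number of subgraphs of $G$ isomorphic to $F$ that contain $v$. A graph $G$ is called $F$-irregular if all its vertices have pairwise distinct $F$-degrees. *)

(* Defs.v *)
From HB Require Import structures.
From mathcomp Require Import all_boot.
Set Implicit Arguments.
Unset Strict Implicit.
Unset Printing Implicit Defensive.

(* An undirected edge uv is the two-element set [set u; v]. *)
Record sgraph := SGraph {
  vertex :> finType;
  edges : {set {set vertex}};
  edges_card2 : forall e, e \in edges -> #|e| = 2
}.

Lemma complete_card2 (n : nat) (e : {set 'I_n}) :
  e \in [set e : {set 'I_n} | #|e| == 2] -> #|e| = 2.
Proof. by rewrite inE => /eqP. Qed.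

Definition complete_graph (n : nat) : sgraph := SGraph (@complete_card2 n).

(* A subgraph, not necessarily induced, is a pair (S, D) of a set of vertices
   and a set of edges. *)
Definition is_subgraph (G : sgraph) (H : {set G} * {set {set G}}) : bool :=
  (H.2 \subset edges G) && [forall e in H.2, e \subset H.1].

(* f is an isomorphism from F onto H: a bijection onto the vertices of H whose
   action on pairs carries the edge set of F exactly onto that of H. *)
Definition iso_to (F G : sgraph) (H : {set G} * {set {set G}}) : bool :=
  [exists f : {ffun F -> G},
    [&& injectiveb f, f @: [set: F] == H.1
      & [set f @: (e : {set F}) | e in edges F] == H.2]].

Definition Fdegree (F G : sgraph) (v : G) : nat :=
  #|[set H : {set G} * {set {set G}} |
      [&& is_subgraph H, iso_to F H & v \in H.1]]|.

Definition irregular (F G : sgraph) : Prop := injective (@Fdegree F G).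

(* Ordinals are 0-based while the vertices are numbered from 1: va i, vb i and
   vc i stand for a_(i+1), b_(i+1) and c_(i+1), hence the successors in the
   index conditions below. *)
Definition V (n : nat) : finType := ('I_3 + 'I_n.+1 + 'I_n.-1 + unit)%type.

Definition va (n : nat) (i : 'I_3) : V n := inl (inl (inl i)).
Definition vb (n : nat) (j : 'I_n.+1) : V n := inl (inl (inr j)).
Definition vc (n : nat) (k : 'I_n.-1) : V n := inl (inr k).
Definition vd (n : nat) : V n := inr tt.

Definition common_edges (n : nat) : {set {set V n}} :=
  [set [set va n i; vb j] | i in 'I_3, j in 'I_n.+1 & i.+1 <= j.+1]
  :|: [set [set vb j; vb l] | j in 'I_n.+1, l in 'I_n.+1 & j.+1 < l.+1]
  :|: [set [set vb j; vc k] | j in 'I_n.+1, k in 'I_n.-1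
                            & (j.+1 <= n) && (k.+1 <= j.+1 + 1)]
  :|: [set [set vc k; vc m] | k in 'I_n.-1, m in 'I_n.-1 & k.+1 < m.+1]
  :|: [set [set va n i; vc k] | i in 'I_3, k in 'I_n.-1
                              & (i.+1 == 3) && (k.+1 == n - 1)]
  :|: [set [set va n i; vd n] | i : 'I_3 & i.+1 == 2].

Definition odd_edges (n : nat) : {set {set V n}} :=
  [set [set vb j; vd n] | j : 'I_n.+1 & 2 <= j.+1 <= n - 1].

Definition even_edges (n : nat) : {set {set V n}} :=
  [set [set vb j; vd n] | j : 'I_n.+1 & 2 <= j.+1 <= n - 3]
  :|: [set [set va n i; vd n] | i : 'I_3 & i.+1 == 1]
  :|: [set [set vb j; vd n] | j : 'I_n.+1 & j.+1 == n + 1].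

Definition edge_set (n : nat) : {set {set V n}} :=
  common_edges n :|: (if odd n then odd_edges n else even_edges n).

Lemma card_V (n : nat) : 0 < n -> #|V n| = 2 * n + 4.
Proof.
case: n => // n _; rewrite !card_sum !card_ord card_unit /=.
by rewrite mulSn mul1n !addnS !addn0 !addSn.
Qed.

Lemma edge_set_card2 (n : nat) (e : {set V n}) : e \in edge_set n -> #|e| = 2.
Proof.
rewrite /edge_set /common_edges /odd_edges /even_edges.
have pair2 (x y : V n) : x != y -> #|[set x; y]| = 2 by move=> xy; rewrite cards2 xy.
have ltb (m : nat) (i j : 'I_m) : i.+1 < j.+1 -> i != j.
  by move=> ij; apply/eqP => e_ij; rewrite e_ij ltnn in ij.
case: (odd n); rewrite !in_setU => He; repeat (case/orP: He => He);
  (case/imset2P: He => x y _ H -> || case/imsetP: He => x H ->);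
  apply: pair2 => //; move: H; rewrite inE => /andP[_ /ltb xy];
  by apply: contraNneq xy => -[->].
Qed.

Definition G (n : nat) : sgraph := SGraph (@edge_set_card2 n).

(* Main.v *)
Require Import Defs.
From mathcomp Require Import all_boot all_fingroup.

(** The vertices [c_1] and [c_2] are adjacent twins: both are joined to
    [b_1, ..., b_n] and to all the other [c_k], and to nothing else, since
    [n - 1 > 2]. Exchanging them is therefore an automorphism of the graph, so
    they have the same [F]-degree for every graph [F]. *)

Set Implicit Arguments.
Unset Strict Implicit.
Unset Printing Implicit Defensive.

Lemma imset_set2 (aT rT : finType) (f : aT -> rT) (x y : aT) :
  f @: [set x; y] = [set f x; f y].
Proof. by rewrite imsetU1 imset_set1. Qed.

Section EdgePreservingPermutation.

Variables (F G : sgraph) (p : {perm G}).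
Hypothesis p_edge : forall e, e \in edges G -> p @: e \in edges G.

Let pmap (H : {set G} * {set {set G}}) :=
  (p @: H.1, [set p @: (e : {set G}) | e in H.2]).

Lemma is_subgraph_perm H : is_subgraph H -> is_subgraph (pmap H).
Proof.
case/andP=> /subsetP sDE /forall_inP sDS; apply/andP; split.
  by apply/subsetP=> _ /imsetP[e eD ->]; apply/p_edge/sDE.
by apply/forall_inP=> _ /imsetP[e eD ->]; apply/imsetS/sDS.
Qed.

(** Composing an isomorphism [f] with [p] works: [pfE] handles the vertex set and each edge
    alike. *)
Lemma iso_to_perm H : iso_to F H -> iso_to F (pmap H).
Proof.
case/existsP=> f /and3P[/injectiveP f_inj /eqP fS /eqP fD].
have pfE (A : {set F}) : [ffun x => p (f x)] @: A = p @: (f @: A).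
  by rewrite -imset_comp; apply: eq_imset => x; rewrite /= ffunE.
apply/existsP; exists [ffun x => p (f x)]; apply/and3P; split.
- by apply/injectiveP=> x y; rewrite !ffunE => /perm_inj/f_inj.
- by rewrite pfE fS.
rewrite /= -fD -imset_comp; apply/eqP; apply: eq_imset => e; exact: pfE.
Qed.

(** [pmap] injects the copies of [F] through [v] into the copies through [p v]. *)
Lemma leq_Fdegree_perm v : Fdegree F v <= Fdegree F (p v).
Proof.
have p_set_inj : injective (fun A : {set G} => p @: A).
  exact/imset_inj/perm_inj.
have pmap_inj : injective pmap.
  case=> S D [S' D'] [/p_set_inj-> eD]; congr pair.
  exact: (imset_inj p_set_inj).
rewrite /Fdegree -(card_imset _ pmap_inj); apply: subset_leq_card.
apply/subsetP=> _ /imsetP[H + ->]; rewrite !inE => /and3P[subH isoH vH].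
by rewrite is_subgraph_perm // iso_to_perm //= imset_f.
Qed.

End EdgePreservingPermutation.

(** The transposition sends [x] to [y] and [y] to [x], so the one-sided bound, used at both
    vertices, gives equality. *)
Lemma Fdegree_tperm (F G : sgraph) (x y : G) :
  (forall e, e \in edges G -> tperm x y @: e \in edges G) ->
  Fdegree F x = Fdegree F y.
Proof.
move=> xy_edge; apply/eqP; rewrite eqn_leq.
have := leq_Fdegree_perm F xy_edge x; rewrite tpermL => ->.
by have := leq_Fdegree_perm F xy_edge y; rewrite tpermR.
Qed.

Section Twins.

Variables (n : nat) (k0 k1 : 'I_n.-1).
Hypotheses (n_gt3 : 3 < n) (k0E : k0 = 0 :> nat) (k1E : k1 = 1 :> nat).

Lemma tperm_edge_set (e : {set V n}) :
  e \in edge_set n -> tperm (vc k0) (vc k1) @: e \in edge_set n.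
Proof.
set p := tperm _ _; set s := tperm k0 k1.
have pa i : p (va n i) = va n i by rewrite /p tpermD.
have pb j : p (@vb n j) = vb j by rewrite /p tpermD.
have pd : p (vd n) = vd n by rewrite /p tpermD.
have pc k : p (vc k) = vc (s k).
  by rewrite /p -inj_tperm // => ? ? [].
(* With 0-based indices, b and c are joined when [k <= j.+1]. This bound is at least 1, so it admits
   both swapped indices 0 and 1, even for the first b. *)
have s_le2 (j : nat) (k : 'I_n.-1) : k <= j.+1 -> s k <= j.+1.
  by rewrite /s; case: tpermP => [->|->|//]; rewrite ?k0E ?k1E.
(* The only c joined to an a has 0-based index [n - 2], which is at least 2 because [3 < n]; the
   swap fixes it. *)
have s_last (k : 'I_n.-1) : k.+1 == n - 1 -> s k = k.
  move=> kn; rewrite /s tpermD //; apply/eqP => ek; move: kn;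
    by rewrite -ek ?k0E ?k1E; case: n n_gt3 => [|[|[|[|]]]].
rewrite /edge_set /common_edges /odd_edges /even_edges.
rewrite !in_setU -!orbA => /or4P[|||/or4P[]].
- case/imset2P=> i j _ + ->; rewrite inE imset_set2 pa pb => ij.
  by apply/or4P/Or41/imset2P; exists i j; rewrite ?inE.
- case/imset2P=> i j _ + ->; rewrite inE imset_set2 !pb => ij.
  by apply/or4P/Or42/imset2P; exists i j; rewrite ?inE.
- case/imset2P=> j k _ + ->; rewrite inE imset_set2 pb pc => /and3P[_ jn kj].
  apply/or4P/Or43/imset2P; exists j (s k) => //.
  by rewrite inE jn addn1 ltnS s_le2 // -ltnS -[j.+2]addn1.
- case/imset2P=> k m _ + ->; rewrite inE imset_set2 !pc => /andP[_ km].
  apply/or4P/Or44/or4P/Or41/imset2P.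
  (* The swap may reverse the order of the two indices, while edges inside the c-clique are listed
     with increasing indices. *)
  have: s k != s m.
    by rewrite (inj_eq perm_inj); apply: contraTneq km => ->; rewrite ltnn.
  rewrite -val_eqE neq_ltn => /orP[lt_s|lt_s].
    by exists (s k) (s m); rewrite ?inE.
  by exists (s m) (s k); rewrite ?inE // setUC.
- case/imset2P=> i k _ + ->; rewrite inE imset_set2 pa pc.
  move=> /and3P[_ i3 kn]; rewrite s_last //.
  by apply/or4P/Or44/or4P/Or42/imset2P; exists i k; rewrite ?inE ?i3.
- case/imsetP=> i i2 ->; rewrite imset_set2 pa pd.
  by apply/or4P/Or44/or4P/Or43/imsetP; exists i.
(* The edges that depend on the parity of [n] contain no c, so each is fixed. *)
move=> He; apply/or4P/Or44/or4P/Or44; move: He.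
case: (odd n); last rewrite !in_setU -!orbA => /or3P[].
all: case/imsetP=> i iP ->; rewrite imset_set2 ?pa ?pb pd.
- by apply/imsetP; exists i.
- by apply/or3P/Or31/imsetP; exists i.
- by apply/or3P/Or32/imsetP; exists i.
- by apply/or3P/Or33/imsetP; exists i.
Qed.

End Twins.

Theorem mainTheorem1 (n : nat) (hn : n = 5 \/ 7 <= n) :
  ~ irregular (complete_graph n) (G n).
Proof.
have n_gt3 : 3 < n by case: hn => [->|/(leq_trans _)->].
have lt0 : 0 < n.-1 by case: n n_gt3 {hn} => [|[|[|[]]]].
have lt1 : 1 < n.-1 by case: n n_gt3 {hn lt0} => [|[|[|[]]]].
move=> irr.
have tw := @tperm_edge_set n (Ordinal lt0) (Ordinal lt1) n_gt3 erefl erefl.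
(* Injectivity would identify the two twins, hence the indices 0 and 1. *)
by have [] := irr _ _ (@Fdegree_tperm (complete_graph n) (G n) _ _ tw).
Qed.
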